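(* If $G\in\widetilde{\mathcal S}$, then $G$ has property $R^{\chi}_\infty$.
   Context: **Property $R^\chi_\infty$.** A group $G$ (not necessarily finitely generated) has property $R^\chi_\infty$ if there is a non-trivial character (homomorphism) $\chi:G\to\mathbb R$ such that $\chi\circ\varphi=\chi$ for all $\varphi\in\mathrm{Aut}(G)$. **Character sphere and $\Sigma^1$.** For a finitely generated group $G$, $S(G)$ is the set of classes $[\chi]$ of nonzero $\chi\in\mathrm{Hom}(G,\mathbb R)$, where $\chi_1\sim\chi_2$ iff $\chi_1=r\chi_2$ for some $r>0$. Let $\Gamma$ be the Cayley graph of $G$ with respect to a finite generating set (edges joining $g$ and $gs$). $\Sigma^1(G)\subset S(G)$ is the set of $[\chi]$ such that the full subgraph of $\Gamma$ on the vertices $\{g\mid\chi(g)\ge0\}$ is path connected (this does not depend on the finite generating set). $\Sigma^1(G)^c=S(G)\setminus\Sigma^1(G)$. **Open hemisphere.** A set of the form $\{[\chi]\in S(G)\mid\chi(g)>0\}$ for some $g\in G$. **Transcendental.** A class $[\chi]$ (or a nonzero character $\chi$) is transcendental if for all nonzero $a,b\in\mathrm{Im}(\chi)$ the ratio $a/b$ is either rational or transcendental. **Spherical polytope.** A subset $P\subset S(G)$ for which there are $v_1,\dots,v_m\in V=\mathrm{Hom}(G,\mathbb R)$ such that (i) some linear map $f:V\to\mathbb R$ has $f(v_j)>0$ for all $j$; (ii) $P=\{[v]\mid v=\sum_j a_jv_j,\ a_j\ge0,\ v\ne0\}$; (iii) $v_1,\dots,v_m$ is a minimal such set, i.e. no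 $v_i$ is a positive linear combination of a subset of $\{v_j: j\ne i\}$. The vertices of $P$ are $[v_1],\dots,[v_m]$. **Class $\mathcal S$.** The class of finitely generated groups $G$ such that (1) $\Sigma^1(G)^c$ is non-empty and lies inside an open hemisphere of $S(G)$; and (2) $\Sigma^1(G)^c$ has finitely many connected components, each of which is a spherical polytope with transcendental vertices. **Class $\widetilde{\mathcal S}$.** The class of all groups $G$ (not necessarily finitely generated) having a characteristic subgroup $K$ with $G/K\in\mathcal S$. *)

(* Defs.v *)
From HB Require Import structures.
From mathcomp Require Import all_boot all_order all_algebra.
From mathcomp Require Import generic_quotient.
From mathcomp Require Import all_classical all_reals all_analysis.

Set Implicit Arguments.
Unset Strict Implicit.
Unset Printing Implicit Defensive.

Import Order.TTheory GRing.Theory Num.Theory.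
Import numFieldNormedType.Exports.

Local Open Scope classical_set_scope.
Local Open Scope quotient_scope.
Local Open Scope ring_scope.

Section Characters.
Variables (R : realType) (G : groupType).

Definition is_hom : {pred (G -> R)} :=
  [pred f : G -> R | `[< {morph f : x y / (x * y)%g >-> x + y} >]].

Fact is_hom_submod_closed : submod_closed is_hom.
Proof.
split=> [|a f g /asboolP fM /asboolP gM]; apply/asboolP => x y /=.
  by rewrite addr0.
change (a * f (x * y)%g + g (x * y)%g = (a * f x + g x) + (a * f y + g y)).
by rewrite fM gM mulrDr addrACA.
Qed.

HB.instance Definition _ :=
  GRing.isSubmodClosed.Build R (G -> R) is_hom is_hom_submod_closed.

Record character :=
  Character { char_fun :> G -> R; char_funP : char_fun \in is_hom }.

HB.instance Definition _ := [isSub for char_fun].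
HB.instance Definition _ := [Choice of character by <:].
HB.instance Definition _ := [SubChoice_isSubLmodule of character by <:].

(* Pointwise convergence; for G finitely generated this is the usual topology
   of the finite-dimensional real vector space Hom(G, R). *)
HB.instance Definition _ := Topological.copy character
  (initial_topology (char_fun : character -> {ptws G -> R})).

Record nonzero_character :=
  NonzeroCharacter { nz_char :> character; nz_charP : nz_char != 0 }.

HB.instance Definition _ := [isSub for nz_char].
HB.instance Definition _ := [Choice of nonzero_character by <:].
HB.instance Definition _ := Topological.copy nonzero_character
  (initial_topology nz_char).

Definition same_ray : rel nonzero_character := fun chi1 chi2 =>
  `[< exists2 r : R, 0 < r & chi1 = r *: (chi2 : character) :> character >].

Fact same_ray_refl : reflexive same_ray.
Proof. by move=> chi; apply/asboolP; exists 1; rewrite ?scale1r. Qed.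

Fact same_ray_sym : symmetric same_ray.
Proof.
have H chi1 chi2 : same_ray chi1 chi2 -> same_ray chi2 chi1.
  move=> /asboolP[r r0 e]; apply/asboolP; exists r^-1; first by rewrite invr_gt0.
  by rewrite e scalerA mulVf ?gt_eqF// scale1r.
by move=> chi1 chi2; apply/idP/idP; exact: H.
Qed.

Fact same_ray_trans : transitive same_ray.
Proof.
move=> chi2 chi1 chi3 /asboolP[r r0 e] /asboolP[s s0 e'].
by apply/asboolP; exists (r * s); rewrite ?mulr_gt0// e e' scalerA.
Qed.

Canonical same_ray_equiv :=
  EquivRel same_ray same_ray_refl same_ray_sym same_ray_trans.

Definition char_sphere := quotient_topology {eq_quot same_ray}.
HB.instance Definition _ := Topological.on char_sphere.

Definition ray (chi : nonzero_character) : char_sphere :=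
  \pi_{eq_quot same_ray} chi.

Lemma ray_eq (chi1 chi2 : nonzero_character) :
  ray chi1 = ray chi2 <->
  exists2 r : R, 0 < r & chi1 = r *: (chi2 : character) :> character.
Proof.
split=> [/eqquotP/asboolP//|h].
by apply/eqquotP/asboolP.
Qed.

Lemma ray_continuous : continuous ray.
Proof. exact: pi_continuous. Qed.

Lemma ray_surj c : exists chi, c = ray chi.
Proof. by exists (repr c); rewrite /ray reprK. Qed.

Definition open_hemisphere (g : G) : set char_sphere :=
  [set ray chi | chi in [set chi : nonzero_character | 0 < chi g]].

Definition generates (S : seq G) :=
  forall H : {pred G}, group_closed H -> {subset S <= H} -> forall x, x \in H.

Definition finitely_generated := exists S : seq G, generates S.

Definition cayley_edge (S : seq G) : rel G := fun x y =>
  ((x^-1 * y)%g \in S) || ((y^-1 * x)%g \in S).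

Definition half_cayley_edge (S : seq G) (chi : character) : rel G := fun x y =>
  [&& 0 <= chi x, 0 <= chi y & cayley_edge S x y].

Definition half_cayley_connected (S : seq G) (chi : character) :=
  forall x y, 0 <= chi x -> 0 <= chi y ->
  exists2 p, path (half_cayley_edge S chi) x p & last x p = y.

(* The generating set may be chosen freely: see Sigma1E below. *)
Definition Sigma1 : set char_sphere :=
  [set ray chi | chi in [set chi : nonzero_character |
    exists2 S, generates S & half_cayley_connected S chi]].

Fact charM (chi : character) (x y : G) : chi (x * y)%g = chi x + chi y.
Proof. by have /asboolP := char_funP chi. Qed.

Fact char1 (chi : character) : chi 1%g = 0.
Proof. by apply: (@addrI _ (chi 1%g)); rewrite -charM mulg1 addr0. Qed.

Fact charV (chi : character) (x : G) : chi x^-1%g = - chi x.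
Proof. by apply: (@addrI _ (chi x)); rewrite -charM mulgV char1 subrr. Qed.

Section Independence.
Variables (T : seq G) (chi : character).
Hypothesis genT : generates T.

Let edge (c : R) : rel G := fun x y =>
  [&& c <= chi x, c <= chi y & cayley_edge T x y].
Let conn (c : R) (x y : G) := exists2 p, path (edge c) x p & last x p = y.

Let conn_refl c x : conn c x x. Proof. by exists [::]. Qed.

Let conn1 c x y : edge c x y -> conn c x y.
Proof. by exists [:: y]; rewrite //= andbT. Qed.

Let conn_trans c y x z : conn c x y -> conn c y z -> conn c x z.
Proof.
by move=> [p ep <-] [q eq <-]; exists (p ++ q); rewrite ?cat_path ?ep ?last_cat.
Qed.

Let edge_sym c x y : edge c x y -> edge c y x.
Proof.
by move=> /and3P[a b e]; rewrite /edge a b /cayley_edge orbC.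
Qed.

Let conn_sym c x y : conn c x y -> conn c y x.
Proof.
move=> [p + <-]; elim: p x => [|z p IH] x //= /andP[xz /IH h].
by apply: conn_trans h _; apply/conn1/edge_sym.
Qed.

Let conn_le c d x y : d <= c -> conn c x y -> conn d x y.
Proof.
move=> dc [p + <-]; elim: p x => [|z p IH] x //= /andP[/and3P[a b e] /IH h].
by apply: conn_trans h; apply/conn1/and3P; split=> //; exact: le_trans dc _.
Qed.

Let conn_mul c z x y : conn c x y -> conn (c + chi z) (z * x)%g (z * y)%g.
Proof.
move=> [p + <-]; elim: p x => [|t p IH] x //= /andP[/and3P[a b e] /IH h].
apply: conn_trans h; apply/conn1/and3P; rewrite !charM.
rewrite ![chi z + _]addrC !lerD2r; split=> //.
by rewrite /cayley_edge !invgM !mulgA !mulgVK.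
Qed.

Let conn_some g : exists c, conn c 1%g g.
Proof.
pose H : {pred G} := [pred g | `[< exists c, conn c 1%g g >]].
have H1 : 1%g \in H by apply/asboolP; exists 0.
have HV : invg_closed H.
  move=> x /asboolP[c cx]; apply/asboolP; exists (c + chi x^-1%g).
  by have := conn_mul x^-1%g cx; rewrite mulg1 mulVg => /conn_sym.
have HM : mulg_closed H.
  move=> x y /asboolP[c cx] /asboolP[d dy]; apply/asboolP.
  exists (Num.min c (d + chi x)); apply: (@conn_trans _ x).
    by apply: conn_le cx; rewrite ge_min lexx.
  have := conn_mul x dy; rewrite mulg1; apply: conn_le.
  by rewrite ge_min lexx orbT.
have Hg : group_closed H by split=> // x y Hx /HV; exact: HM.
suff /(genT Hg)/(_ g)/asboolP : {subset T <= H} by [].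
move=> t Tt; apply/asboolP; exists (Num.min 0 (chi t)); apply: conn1.
rewrite /edge char1 !ge_min !lexx orbT /=.
by rewrite /cayley_edge invg1 mul1g Tt.
Qed.

Let conn_all (S : seq G) : exists c, {in S, forall s, conn c 1%g s}.
Proof.
elim: S => [|s S [c IH]]; first by exists 0.
have [d ds] := conn_some s; exists (Num.min c d) => t.
rewrite inE => /predU1P[->|/IH].
- by move: ds; apply: conn_le; rewrite ge_min lexx orbT.
- by apply: conn_le; rewrite ge_min lexx.
Qed.

Let conn_half (S : seq G) : half_cayley_connected S chi ->
  exists c, forall g, 0 <= chi g -> conn c 1%g g.
Proof.
move=> hS; have [c cS] := conn_all S; exists c => g g0.
have /hS/(_ g0)[p + <-] : 0 <= chi 1%g by rewrite char1.
have aux u v : 0 <= chi u -> (u^-1 * v)%g \in S -> conn c u v.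
  move=> u0 /cS /(conn_mul u); rewrite mulg1 mulgA mulgV mul1g.
  by apply: conn_le; rewrite lerDl.
elim: p (1%g : G) => [|z p IH] x //= /andP[/and3P[a b e] /IH h].
apply: conn_trans h; case/orP: e; last by move/(aux _ _ b)/conn_sym.
exact: aux.
Qed.

Lemma half_cayley_connected_indep (S : seq G) :
  chi != 0 -> half_cayley_connected S chi -> half_cayley_connected T chi.
Proof.
move=> chi0 /conn_half[c hc].
have [t Tt t0] : exists2 t, t \in T & chi t != 0.
  apply: contrapT => nT; move/negP: chi0; apply; apply/eqP/val_inj/funext => g.
  pose H : {pred G} := [pred g | chi g == 0].
  have H1 : 1%g \in H by rewrite inE char1.
  have HV : invg_closed H by move=> x; rewrite !inE charV oppr_eq0.
  have HM : mulg_closed H.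
    by move=> x y; rewrite !inE charM => /eqP-> /eqP->; rewrite addr0.
  have Hg : group_closed H by split=> // x y Hx /HV; exact: HM.
  suff /(genT Hg)/(_ g)/eqP : {subset T <= H} by [].
  move=> t Tt; rewrite inE; apply: contrapT => /negP t0.
  by apply: nT; exists t.
have [u Tu u0] : exists2 u, (u \in T) || (u^-1%g \in T) & 0 < chi u.
  have [t_gt0|t_lt0|/eqP] := ltgtP 0 (chi t); last by rewrite eq_sym (negbTE t0).
  - by exists t; rewrite ?Tt.
  - by exists t^-1%g; rewrite ?invgK ?Tt ?orbT// charV oppr_gt0.
have up x n : 0 <= chi x -> conn 0 x (x * u ^+ n)%g.
  elim: n x => [|n IH] x x0; first by rewrite expg0 mulg1.
  have xu0 : 0 <= chi (x * u)%g by rewrite charM addr_ge0// ltW.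
  rewrite expgS mulgA; apply: conn_trans (IH _ xu0).
  by apply/conn1/and3P; split=> //; rewrite /cayley_edge mulKg invgM mulgVK.
have [n nc] : exists n : nat, - c <= chi (u ^+ n)%g.
  have e n : chi (u ^+ n)%g = chi u *+ n.
    by elim: n => [|n IH]; rewrite ?expg0 ?char1// expgS charM IH mulrS.
  exists (Num.bound `|- c / chi u|); rewrite e -mulr_natl -ler_pdivrMr//.
  apply: ltW; apply: le_lt_trans (ler_norm _) _.
  exact: archi_boundP.
have c1 g : 0 <= chi g -> conn 0 1%g g.
  move=> g0; set z := (u ^+ n)%g in nc.
  have : 0 <= chi (z^-1 * g * z)%g by rewrite !charM charV addrAC addNr add0r.
  move/hc/(conn_mul z); rewrite mulg1 !mulgA mulgV mul1g => zgz.
  apply: (@conn_trans _ z); first by have := up 1%g n; rewrite mul1g char1; apply.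
  apply: (@conn_trans _ (g * z)%g); last exact/conn_sym/up.
  by apply: conn_le zgz; rewrite -lerBlDl sub0r.
by move=> x y /c1/conn_sym x0 /c1; exact: conn_trans x0.
Qed.

End Independence.

Lemma Sigma1E (S : seq G) : generates S ->
  Sigma1 = [set ray chi | chi in
    [set chi : nonzero_character | half_cayley_connected S chi]].
Proof.
move=> genS; apply/seteqP; split=> _ [chi /= h <-]; exists chi => //=.
  by case: h => S' _; apply: half_cayley_connected_indep => //; exact: nz_charP.
by exists S.
Qed.

Definition transcendental (chi : character) :=
  forall a b : R, range chi a -> range chi b -> a != 0 -> b != 0 ->
  (exists q : rat, a / b = ratr q) \/
  ~ algebraicOver (ratr : rat -> R) (a / b).

Definition positive_combination_of_others m (v : 'I_m -> character) (i : 'I_m) :=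
  exists (J : {set 'I_m}) (a : 'I_m -> R),
    [/\ i \notin J, (forall j, j \in J -> 0 < a j) &
        v i = \sum_(j in J) a j *: v j].

(* The case m = 0 describes the empty set, which is not a connected component
   of a nonempty set; all the v j are nonzero since 0 < f (v j). *)
Definition polytope_vertices m (v : 'I_m -> character) (P : set char_sphere) :=
  [/\ exists f : {scalar character}, forall j, 0 < f (v j),
      P = [set ray chi | chi in [set chi : nonzero_character |
            exists2 a : 'I_m -> R, (forall j, 0 <= a j) &
              chi = \sum_j a j *: v j :> character]]
    & forall i, ~ positive_combination_of_others v i].

Definition transcendental_polytope (P : set char_sphere) :=
  exists (m : nat) (v : 'I_m -> character),
    polytope_vertices v P /\ forall j, transcendental (v j).

Definition class_S :=
  [/\ finitely_generated,
      ~` Sigma1 !=set0 /\ (exists g, ~` Sigma1 `<=` open_hemisphere g),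
      finite_set [set connected_component (~` Sigma1) c | c in ~` Sigma1]
    & forall c, (~` Sigma1) c ->
        transcendental_polytope (connected_component (~` Sigma1) c)].

Definition property_R_chi_infty :=
  exists2 chi : character, chi != 0 &
    forall phi : {multiplicative G -> G}, bijective phi ->
      chi \o phi = chi :> (G -> R).

End Characters.
Arguments ray {R G}.

Section QuotientGroup.
Variable G : groupType.

Record normal_subgroup := NormalSubgroup {
  nsub :> groupClosed G;
  nsub_conj : forall x g, x \in nsub -> (x ^ g)%g \in nsub }.

Variable K : normal_subgroup.

Definition same_coset : rel G := fun x y => (x^-1 * y)%g \in (K : {pred G}).

Fact same_coset_refl : reflexive same_coset.
Proof. by move=> x; rewrite /same_coset mulVg gpred1. Qed.

Fact same_coset_sym : symmetric same_coset.
Proof. by move=> x y; rewrite /same_coset -gpredV invgM invgK. Qed.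

Fact same_coset_trans : transitive same_coset.
Proof.
by move=> y x z /gpredM h /h; rewrite mulgA mulgK.
Qed.

Canonical same_coset_equiv :=
  EquivRel same_coset same_coset_refl same_coset_sym same_coset_trans.

Definition quotient_group := {eq_quot same_coset}.
HB.instance Definition _ := Choice.on quotient_group.
HB.instance Definition _ := EqQuotient.on quotient_group.

Definition qg_one : quotient_group := \pi_quotient_group 1%g.
Definition qg_inv : quotient_group -> quotient_group :=
  fun a => \pi_quotient_group (repr a)^-1%g.
Definition qg_mul : quotient_group -> quotient_group -> quotient_group :=
  fun a b => \pi_quotient_group (repr a * repr b)%g.

Fact pi_qg_inv (x : G) :
  qg_inv (\pi_quotient_group x) = \pi_quotient_group (x^-1)%g.
Proof.
apply/eqmodP => /=.
have /eqmodP/= : repr (\pi_quotient_group x) = x %[mod quotient_group].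
  by rewrite reprK.
move: (repr _) => y; rewrite /same_coset /= => Kxy.
have := nsub_conj y^-1%g Kxy.
by rewrite -gpredV conjgE !invgM !invgK !mulgA mulgK.
Qed.

Fact pi_qg_mul (x y : G) :
  qg_mul (\pi_quotient_group x) (\pi_quotient_group y)
  = \pi_quotient_group (x * y)%g.
Proof.
apply/eqmodP => /=.
have /eqmodP/= : repr (\pi_quotient_group x) = x %[mod quotient_group].
  by rewrite reprK.
have /eqmodP/= : repr (\pi_quotient_group y) = y %[mod quotient_group].
  by rewrite reprK.
set x' := repr (\pi_quotient_group x); set y' := repr (\pi_quotient_group y).
rewrite /same_coset /= => Ky Kx.
have /gpredM/(_ Ky) := nsub_conj y' Kx.
by rewrite conjgE invgM !mulgA mulgK.
Qed.

Fact qg_mulA : associative qg_mul.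
Proof.
elim/quotW=> x; elim/quotW=> y; elim/quotW=> z.
by rewrite (pi_qg_mul y z) (pi_qg_mul x y) (pi_qg_mul x) (pi_qg_mul _ z) mulgA.
Qed.

Fact qg_mul1 : left_id qg_one qg_mul.
Proof. by elim/quotW=> x; rewrite (pi_qg_mul 1%g x) mul1g. Qed.

Fact qg_mulr1 : right_id qg_one qg_mul.
Proof. by elim/quotW=> x; rewrite (pi_qg_mul x 1%g) mulg1. Qed.

Fact qg_mulV : left_inverse qg_one qg_inv qg_mul.
Proof. by elim/quotW=> x; rewrite (pi_qg_inv x) (pi_qg_mul _ x) mulVg. Qed.

Fact qg_mulrV : right_inverse qg_one qg_inv qg_mul.
Proof. by elim/quotW=> x; rewrite (pi_qg_inv x) (pi_qg_mul x _) mulgV. Qed.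

HB.instance Definition _ := isGroup.Build quotient_group
  qg_mulA qg_mul1 qg_mulr1 qg_mulV qg_mulrV.

Definition characteristic :=
  forall phi : {multiplicative G -> G}, bijective phi ->
    phi @` [set` K] = [set` K].

End QuotientGroup.

Definition class_S_tilde (R : realType) (G : groupType) :=
  exists K : normal_subgroup G,
    characteristic K /\ class_S R (quotient_group K).

(* Main.v *)
(* An automorphism of G acts on S(G) by a homeomorphism preserving the complement
   of Sigma^1, so it permutes the finitely many components and, since the vertices
   of a spherical polytope are exactly its extremal rays, the finitely many rays
   spanned by the vertices.  If the character chi spanning such a ray satisfies
   chi o f = r chi with r > 0, then multiplication by r and by 1/r preserves the
   finitely generated group Im(chi), so r is an algebraic integer and a unit;
   transcendence makes r rational, hence r = 1.  Therefore each ray contains at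
   most one element of the Aut(G)-orbit of chi, and this orbit is finite.  The sum
   of the orbit is an invariant character, nonzero because all its terms are
   positive at the element defining the hemisphere.  Finally an invariant character
   of G/K pulls back to one of G when K is characteristic. *)

From HB Require Import structures.
Require Import Defs.
From mathcomp Require Import all_boot all_order all_algebra all_field.
From mathcomp Require Import generic_quotient.
From mathcomp Require Import all_classical all_reals all_analysis.

Set Implicit Arguments.
Unset Strict Implicit.
Unset Printing Implicit Defensive.

Import Order.TTheory GRing.Theory Num.Theory.
Import numFieldNormedType.Exports.

Local Open Scope classical_set_scope.
Local Open Scope quotient_scope.
Local Open Scope ring_scope.

(** * Rational roots of monic integer polynomials *)

Lemma rat_root_monic_int (p : {poly int}) (q : rat) :
  p \is monic -> root (map_poly intr p) q -> q \is a Num.int.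
Proof.
move=> mp rp.
(* In [algC] the root is an algebraic integer, and a rational algebraic integer is an integer. *)
have : (ratr q : algC) \in Aint.
  apply: (@root_monic_Aint (map_poly intr p)).
  - rewrite -(fmorph_root (ratr : rat -> algC)) -map_poly_comp in rp.
    by rewrite (eq_map_poly (g := intr)) in rp => // x /=; rewrite ratr_int.
  - exact: monic_map.
  - by apply/polyOverP => i; rewrite coef_map/= intr_int.
move/(Cint_rat_Aint (Crat_rat q)) => /intrP[n].
by rewrite -(ratr_int algC) => /fmorph_inj ->.
Qed.

(** * Group homomorphisms and pullback of characters *)

Section MultiplicativeGroup.
Variables (G H : groupType) (f : {multiplicative G -> H}).

Lemma multiplicative1 : f 1%g = 1%g.
Proof. by apply: (@mulgI _ (f 1%g)); rewrite -gmulfM !mulg1. Qed.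

Lemma multiplicativeV : {morph f : x / x^-1%g}.
Proof.
by move=> x; apply: (@mulgI _ (f x)); rewrite -gmulfM !mulgV multiplicative1.
Qed.

End MultiplicativeGroup.

Lemma multiplicative_inverse (G H : groupType) (f : {multiplicative G -> H}) :
  bijective f ->
  exists g : {multiplicative H -> G}, cancel f g /\ cancel g f.
Proof.
move=> [g fK gK].
have gM := can2_gmulfM fK gK.
by exists (HB.pack_for {multiplicative H -> G} g
  (isMultiplicative.Build _ _ g gM)).
Qed.

Section Pullback.
Variables (R : realType) (G H : groupType) (f : {multiplicative G -> H}).

Fact char_comp_subproof (chi : character R H) : chi \o f \in @is_hom R G.
Proof. by apply/asboolP => x y /=; rewrite gmulfM charM. Qed.

Definition char_comp (chi : character R H) : character R G :=
  Character (char_comp_subproof chi).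

Fact char_comp_linear : linear char_comp.
Proof. by move=> a chi psi; apply/val_inj/funext. Qed.

HB.instance Definition _ :=
  GRing.isLinear.Build R (character R H) (character R G) *:%R char_comp
    char_comp_linear.

Lemma char_comp_neq0 (chi : character R H) :
  bijective f -> chi != 0 -> char_comp chi != 0.
Proof.
move=> [g _ gK]; apply: contraNN => /eqP e; apply/eqP/val_inj/funext => x.
by rewrite -[x]gK; exact: (congr1 (fun psi : character R G => psi (g x)) e).
Qed.

End Pullback.

Lemma character_eqP (R : realType) (G : groupType) (chi psi : character R G) :
  chi =1 psi <-> chi = psi.
Proof. by split=> [e|->//]; apply/val_inj/funext. Qed.

Lemma char_scaleE (R : realType) (G : groupType) (r : R)
    (chi : character R G) (g : G) :
  (r *: chi) g = r * chi g.
Proof. by []. Qed.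

Lemma char_compK (R : realType) (G H : groupType) (f : {multiplicative G -> H})
    (g : {multiplicative H -> G}) :
  cancel g f -> cancel (@char_comp R G H f) (char_comp g).
Proof. by move=> gK chi; apply/character_eqP => x /=; rewrite gK. Qed.

(** * Rigidity of rays fixed by an automorphism *)

Section IntegralScaling.
Variables (R : realType) (G : groupType).
Implicit Types (chi : character R G) (r : R).

(** The elements admitting such coefficients form a subgroup containing [S]. *)
Lemma char_integer_combination (S : seq G) chi (g : G) : generates S ->
  exists a : 'I_(size S) -> int,
    chi g = \sum_i (a i)%:~R * chi (tnth (in_tuple S) i).
Proof.
move=> genS.
pose H : {pred G} := [pred g | `[< exists a : 'I_(size S) -> int,
  chi g = \sum_i (a i)%:~R * chi (tnth (in_tuple S) i) >]].
have HB x y : x \in H -> y \in H -> (x * y^-1)%g \in H.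
  move=> /asboolP[a xa] /asboolP[b yb]; apply/asboolP.
  exists (fun i => a i - b i).
  rewrite charM charV xa yb -sumrB; apply: eq_bigr => i _.
  by rewrite intrB mulrBl.
have H1 : 1%g \in H.
  apply/asboolP; exists (fun=> 0); rewrite char1 big1// => i _.
  by rewrite mul0r.
suff /(genS H (conj H1 HB))/(_ g)/asboolP : {subset S <= H} by [].
move=> s sS; apply/asboolP.
have [i ->] := tnthP (in_tuple S) s sS.
exists (fun j => (j == i)%:R).
rewrite (bigD1 i)//= eqxx mul1r big1 ?addr0// => j.
by move=> /negbTE->; rewrite mul0r.
Qed.

(* Cayley-Hamilton trick: multiplication by [r] preserves the finitely generated
   subgroup [Im chi] of R, so [r] is an eigenvalue of an integer matrix. *)
Lemma stable_scaling_integral chi r :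
  finitely_generated G -> chi != 0 ->
  (forall g, exists h, chi h = r * chi g) ->
  exists2 p : {poly int}, p \is monic & root (map_poly intr p) r.
Proof.
move=> [S genS] chi0 st.
have /choice[a aP] : forall i : 'I_(size S), exists a : 'I_(size S) -> int,
    r * chi (tnth (in_tuple S) i) =
    \sum_j (a j)%:~R * chi (tnth (in_tuple S) j).
  move=> i; have [h <-] := st (tnth (in_tuple S) i).
  exact: char_integer_combination.
(* The coefficients are transposed because eigenvectors are rows; the eigenvector will be the row of
   values of [chi] on [S]. *)
pose A : 'M[int]_(size S) := \matrix_(i, j) a j i.
exists (char_poly A); first exact: char_poly_monic.
rewrite map_char_poly -eigenvalue_root_char; apply/eigenvalueP.
exists (\row_i chi (tnth (in_tuple S) i)).
  apply/rowP => i; rewrite !mxE aP; apply: eq_bigr => j _.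
  by rewrite !mxE mulrC.
(* A character vanishing on the generators is zero. *)
apply: contra_neq chi0 => u0; apply/character_eqP => g.
have [b ->] := char_integer_combination chi g genS.
rewrite big1// => i _; have := congr1 (fun u : 'rV_ _ => u 0 i) u0.
by rewrite !mxE => ->; rewrite mulr0.
Qed.

(** Since [r] is the ratio of the values of [chi] at [f g] and [g], it is rational or
    transcendental; being an algebraic integer, it is a rational integer. *)
Lemma transcendental_scaling_int chi r (f : {multiplicative G -> G}) :
  finitely_generated G -> chi != 0 -> transcendental chi ->
  r != 0 -> char_comp f chi = r *: chi -> exists n : int, r = n%:~R.
Proof.
move=> fgG chi0 trchi r0 fchi.
have fE g : chi (f g) = r * chi g by have /character_eqP/(_ g) := fchi.
have [p mp rp] : exists2 p : {poly int}, p \is monic & root (map_poly intr p) r.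
  by apply: stable_scaling_integral fgG chi0 _ => g; exists (f g).
have [g g0] : exists g, chi g != 0.
  apply: contrapT => /forallNP nex; move/eqP: chi0; apply.
  by apply/character_eqP => g; apply/eqP; apply: contrapT => /negP; exact: nex.
have fg0 : chi (f g) != 0 by rewrite fE mulf_neq0.
have := trchi _ _ (imageT chi (f g)) (imageT chi g) fg0 g0.
rewrite fE mulfK// => -[[q qr]|]; last first.
  case; exists (map_poly intr p); first exact/monic_neq0/monic_map.
  rewrite -map_poly_comp (eq_map_poly (g := intr))// => x /=.
  by rewrite ratr_int.
have /intrP[n qn] : q \is a Num.int.
  apply: rat_root_monic_int mp _; rewrite -(fmorph_root (ratr : rat -> R)).
  rewrite -map_poly_comp (eq_map_poly (g := intr)); last first.
    by move=> x /=; rewrite ratr_int.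
  by move: rp; rewrite qr.
by exists n; rewrite qr qn ratr_int.
Qed.

(** Applied to [f] and to its inverse, integrality makes both [r] and [r^-1] positive integers,
    hence both at least 1. *)
Lemma transcendental_fixed_ray chi r (f : {multiplicative G -> G}) :
  finitely_generated G -> chi != 0 -> transcendental chi -> bijective f ->
  0 < r -> char_comp f chi = r *: chi -> r = 1.
Proof.
move=> fgG chi0 trchi /multiplicative_inverse[g [fK gK]] r0 fchi.
have rn0 : r != 0 by rewrite gt_eqF.
have gchi : char_comp g chi = r^-1 *: chi.
  apply: (scalerI rn0); rewrite -linearZ/= -fchi (char_compK gK).
  by rewrite scalerA mulfV// scale1r.
have [n rE] := transcendental_scaling_int fgG chi0 trchi rn0 fchi.
have [m rVE] := transcendental_scaling_int fgG chi0 trchi (invr_neq0 rn0) gchi.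
have r_ge1 : 1 <= r.
  by rewrite rE -[1]/(1%:~R) ler_int -gtz0_ge1 -(ltr_int R) -rE.
have rV_ge1 : 1 <= r^-1.
  by rewrite rVE -[1]/(1%:~R) ler_int -gtz0_ge1 -(ltr_int R) -rVE invr_gt0.
by apply/le_anti; rewrite r_ge1 andbT -[r]invrK invf_le1// invr_gt0.
Qed.

End IntegralScaling.

(** * Action of automorphisms on the character sphere *)

Lemma ptws_continuous (X : topologicalType) (U : eqType) (V : topologicalType)
    (h : X -> {ptws U -> V}) :
  (forall u, continuous (fun x => h x u)) -> continuous h.
Proof.
move=> hc x; apply/cvg_sup => u.
exact: (@continuous_comp_initial _ _ _ (fun k : U -> V => k u) h (hc u)).
Qed.

Section SphereAction.
Variables (R : realType) (G : groupType) (f : {multiplicative G -> G}).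
Hypothesis bf : bijective f.

Definition nz_char_comp (chi : nonzero_character R G) : nonzero_character R G :=
  NonzeroCharacter (char_comp_neq0 bf (nz_charP chi)).

(** The choice of representative is immaterial, because pullback is linear and so respects positive
    scaling. *)
Definition sphere_comp (c : char_sphere R G) : char_sphere R G :=
  ray (nz_char_comp (repr c)).

Lemma sphere_comp_ray (chi : nonzero_character R G) :
  sphere_comp (ray chi) = ray (nz_char_comp chi).
Proof.
have : ray (repr (ray chi)) = ray chi by rewrite /ray reprK.
move=> /ray_eq[r r0 e]; apply/ray_eq; exists r => //=.
by rewrite e linearZ.
Qed.

(** All topologies involved are initial, so continuity is tested on evaluations; evaluating the
    pullback at [x] is evaluating [chi] at [f x]. *)
Lemma nz_char_comp_continuous : continuous nz_char_comp.
Proof.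
apply: continuous_comp_initial; apply: continuous_comp_initial.
apply: ptws_continuous => x.
have nz_cont : continuous (@nz_char R G) by exact: initial_continuous.
have char_cont : continuous (@char_fun R G : character R G -> {ptws G -> R}).
  exact: initial_continuous.
move=> chi.
apply: (@continuous_comp _ _ _
    (fun psi : nonzero_character R G => char_fun psi : {ptws G -> R})
    (fun k : {ptws G -> R} => k (f x))).
  by apply: continuous_comp; [exact: nz_cont|exact: char_cont].
exact: (@proj_continuous G (fun=> R)).
Qed.

Lemma sphere_comp_continuous : continuous sphere_comp.
Proof.
apply/quotient_continuous.
rewrite (_ : _ \o _ = ray \o nz_char_comp); last first.
  by apply/funext => chi; exact: sphere_comp_ray.
move=> chi; apply: continuous_comp; first exact: nz_char_comp_continuous.
exact: ray_continuous.
Qed.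

(** The inverse [g] of [f] maps the Cayley graph of [S] onto that of the image of [S], and the half
    where [chi] is nonnegative onto the half for the pullback. *)
Lemma Sigma1_sphere_comp c : Sigma1 c -> Sigma1 (sphere_comp c).
Proof.
move=> [chi [S genS conS] <-]; rewrite sphere_comp_ray.
have [g [fK gK]] := multiplicative_inverse bf.
exists (nz_char_comp chi) => //; exists (map g S).
  move=> H [H1 HB] SH x.
  (* The preimage of [H] under [g] is a subgroup containing [S]. *)
  suff : f x \in [pred y | g y \in H] by rewrite inE fK.
  apply: genS; last by move=> s sS; rewrite inE SH// map_f.
  split=> [|y z]; rewrite !inE ?multiplicative1// gmulfM multiplicativeV.
  exact: HB.
move=> x y /= x0 y0; have [p pe py] := conS _ _ x0 y0.
exists (map g p); last by rewrite -[x]fK last_map py fK.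
rewrite -[x]fK.
elim: p (f x) pe {py x0} => //= z p IH t /andP[/and3P[t0 z0 e] /IH ->].
rewrite andbT /half_cayley_edge/= !gK t0 z0/=.
by rewrite /cayley_edge -!multiplicativeV -!gmulfM !(mem_map (can_inj gK)).
Qed.

End SphereAction.

Arguments sphere_comp {R G f}.
Arguments nz_char_comp {R G f}.

Section SphereActionComponents.
Variables (R : realType) (G : groupType) (f g : {multiplicative G -> G}).
Hypotheses (bf : bijective f) (bg : bijective g).
Hypothesis gK : cancel g f.

Lemma nz_char_compK : cancel (@nz_char_comp R G f bf) (nz_char_comp bg).
Proof. by move=> chi; apply/val_inj/char_compK. Qed.

Lemma sphere_compK : cancel (@sphere_comp R G f bf) (sphere_comp bg).
Proof.
move=> c; have [chi ->] := ray_surj c.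
by rewrite !sphere_comp_ray nz_char_compK.
Qed.

End SphereActionComponents.

Lemma connected_component_image (T : topologicalType) (h : T -> T) (A : set T)
    (x y : T) : continuous h -> h @` A `<=` A ->
  connected_component A x y -> connected_component A (h x) (h y).
Proof.
move=> hc hA [B [Bx BA cB] By]; exists (h @` B); last by exists y.
split; first by exists x.
- by apply: subset_trans hA; exact: image_subset.
- by apply: connected_continuous_connected => //; exact: continuous_subspaceT.
Qed.

(** * Extremal rays of spherical polytopes *)

Section ExtremalRays.
Variables (R : realType) (G : groupType).
Implicit Types (P : set (char_sphere R G)) (chi : nonzero_character R G).

(** Extreme rays of the cone over [P], described without a list of vertices so that linear
    automorphisms transport them. Constraining [psi1] alone suffices by symmetry of the sum. *)
Definition extremal P chi := P (ray chi) /\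
  forall psi1 psi2 : nonzero_character R G, P (ray psi1) -> P (ray psi2) ->
    (chi : character R G) = (psi1 : character R G) + psi2 ->
    ray psi1 = ray chi.

Lemma extremal_nz_char_comp (f g : {multiplicative G -> G})
    (bf : bijective f) (bg : bijective g) P P' chi :
  cancel f g -> cancel g f ->
  P' (sphere_comp bf (ray chi)) ->
  (forall c, P' c -> P (sphere_comp bg c)) ->
  extremal P chi -> extremal P' (nz_char_comp bf chi).
Proof.
move=> fK gK P'chi P'P [Pchi ext]; split; first by rewrite -sphere_comp_ray.
move=> psi1 psi2 P1 P2 e.
rewrite -(nz_char_compK bg bf fK psi1).
rewrite -[LHS]sphere_comp_ray -[RHS]sphere_comp_ray.
apply: congr1.
(* Pulling the splitting back along [g] gives a splitting of [chi] itself. *)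
apply: (ext _ (nz_char_comp bg psi2)).
- by rewrite -sphere_comp_ray; exact: P'P.
- by rewrite -sphere_comp_ray; exact: P'P.
- by rewrite /= -linearD/= -e/= char_compK.
Qed.

Section Polytope.
Variables (m : nat) (v : 'I_m -> character R G) (P : set (char_sphere R G)).
Hypothesis vP : polytope_vertices v P.

Fact vertex_neq0 j : v j != 0.
Proof.
have [[h h0] _ _] := vP; have := h0 j.
by apply: contraTneq => ->; rewrite linear0 ltxx.
Qed.

Definition vertex j := NonzeroCharacter (vertex_neq0 j).

Lemma polytope_rayP chi : P (ray chi) <->
  exists2 a : 'I_m -> R, (forall j, 0 <= a j) &
    chi = \sum_j a j *: v j :> character R G.
Proof.
have [_ -> _] := vP.
split=> [[psi /= [a a0 e] /ray_eq[r r0 e']]|]; last by exists chi.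
exists (fun j => r^-1 * a j) => [j|]; first by rewrite mulr_ge0// invr_ge0 ltW.
transitivity (r^-1 *: (psi : character R G)).
  by rewrite e' scalerA mulVf ?scale1r// gt_eqF.
by rewrite e scaler_sumr; apply: eq_bigr => j _; rewrite scalerA.
Qed.

(** A splitting of [v j] in the cone adds up to coefficients [c]. Minimality of the vertices forces
    [1 <= c j]; the functional [h], positive on every vertex, then kills the other coefficients. *)
Lemma extremal_vertex j : extremal P (vertex j).
Proof.
have [[h h0] _ vmin] := vP; split.
  apply/polytope_rayP; exists (fun i => (i == j)%:R) => [i|].
    by rewrite ler0n.
  rewrite (bigD1 j)//= eqxx scale1r big1 ?addr0// => i /negbTE->.
  by rewrite scale0r.
move=> psi1 psi2 /polytope_rayP[a a0 e1] /polytope_rayP[b b0 e2] /= e12.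
pose c i := a i + b i.
have c0 i : 0 <= c i by rewrite addr_ge0.
have cE : (1 - c j) *: v j = \sum_(i | i != j) c i *: v i.
  rewrite scalerBl scale1r {1}e12 e1 e2 -big_split/= (bigD1 j)//=.
  rewrite -!scalerDl addrAC subrr add0r.
  by apply: eq_bigr => i _; rewrite scalerDl.
have cj_ge1 : 1 <= c j.
  rewrite leNgt; apply/negP => cj1; have d0 : 0 < 1 - c j by rewrite subr_gt0.
  (* Dividing [cE] by [1 - c j] exhibits [v j] as a combination of other vertices; vanishing
     coefficients are dropped to get strict positivity. *)
  apply: (vmin j); exists [set i | (i != j) && (0 < c i)]%SET.
  exists (fun i => (1 - c j)^-1 * c i).
  split=> [|i|]; first by rewrite inE eqxx.
  - by rewrite inE => /andP[_ ci]; rewrite mulr_gt0// invr_gt0.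
  transitivity ((1 - c j)^-1 *: \sum_(i | i != j) c i *: v i).
    by rewrite -cE scalerA mulVf ?scale1r// gt_eqF.
  rewrite scaler_sumr (bigID (fun i => 0 < c i))/= [X in _ + X]big1 ?addr0.
    by apply: eq_big => [i|i _]; rewrite ?inE// scalerA.
  move=> i /andP[_]; rewrite lt_neqAle c0 andbT negbK => /eqP <-.
  by rewrite scale0r scaler0.
have ci0 i : i != j -> c i = 0.
  (* Applying [h] to [cE] gives a nonpositive left side, while every term on the right is
     nonnegative. *)
  have s0 : \sum_(i | i != j) c i * h (v i) <= 0.
    have := congr1 h cE; rewrite linearZ linear_sum/=.
    under eq_bigr do rewrite linearZ/=.
    by move=> <-; rewrite mulr_le0_ge0 ?subr_le0// ltW.
  have t0 k : k != j -> 0 <= c k * h (v k) by rewrite mulr_ge0// ltW.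
  move=> ij; apply/eqP; have : c i * h (v i) == 0.
    rewrite eq_le t0// andbT; apply: le_trans s0.
    rewrite (bigD1 i)//= lerDl sumr_ge0// => k /andP[kj _]; exact: t0.
  by rewrite mulf_eq0 (gt_eqF (h0 i)) orbF.
have ai0 i : i != j -> a i = 0.
  move=> /ci0/eqP; rewrite paddr_eq0// => /andP[/eqP//].
have psi1E : psi1 = a j *: v j :> character R G.
  rewrite e1 (bigD1 j)//= big1 ?addr0// => i /ai0->; exact: scale0r.
apply/ray_eq; exists (a j) => //; rewrite lt_neqAle a0 andbT eq_sym.
by apply: contraNneq (nz_charP psi1) => aj0; rewrite psi1E aj0 scale0r.
Qed.

(** Split off from [chi] one term [a j *: v j] with nonzero coefficient: by extremality it lies on
    the ray of [chi]. *)
Lemma extremal_is_vertex chi :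
  extremal P chi -> exists j, ray chi = ray (vertex j).
Proof.
move=> [Pchi ext]; have /polytope_rayP[a a0 e] := Pchi.
have [j aj] : exists j, a j != 0.
  apply: contrapT => /forallNP na; have /eqP := nz_charP chi; apply.
  rewrite e big1// => j _; have /negP := na j; rewrite negbK => /eqP->.
  exact: scale0r.
have aj0 : 0 < a j by rewrite lt_neqAle eq_sym aj a0.
exists j; have avj : a j *: v j != 0.
  by rewrite scaler_eq0 negb_or aj vertex_neq0.
have <- : ray (NonzeroCharacter avj) = ray (vertex j).
  by apply/ray_eq; exists (a j).
(* Extremality only speaks of nonzero summands, so a zero remainder is treated apart. *)
have [r0|r0] := eqVneq (\sum_(i | i != j) a i *: v i) 0.
  by apply/ray_eq; exists 1 => //; rewrite scale1r/= e (bigD1 j)//= r0 addr0.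
apply/esym/(ext _ (NonzeroCharacter r0)); last by rewrite e (bigD1 j).
- apply/polytope_rayP; exists (fun i => if i == j then a j else 0) => [i|].
    by case: ifP.
  by rewrite /= (bigD1 j)//= eqxx big1 ?addr0// => i /negbTE->; rewrite scale0r.
- apply/polytope_rayP; exists (fun i => if i != j then a i else 0) => [i|].
    by case: ifP.
  rewrite /= [RHS](bigD1 j)//= eqxx scale0r add0r.
  by apply: eq_bigr => i ->.
Qed.

End Polytope.

Lemma finite_extremal_rays m (v : 'I_m -> character R G) P :
  polytope_vertices v P -> finite_set [set ray chi | chi in extremal P].
Proof.
move=> vP.
apply: (@sub_finite_set _ _ [set ray (vertex vP j) | j in [set: 'I_m]]).
  by move=> _ [chi /(extremal_is_vertex vP)[j ->] <-]; exists j.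
exact/finite_image/finite_finset.
Qed.

End ExtremalRays.

(** * Finiteness of vertex orbits and the invariant character *)

Section VertexOrbit.
Variables (R : realType) (G : groupType).

Local Notation A := (~` @Sigma1 R G).
Implicit Types chi psi : nonzero_character R G.

Lemma setC_Sigma1_sphere_comp (f : {multiplicative G -> G})
    (bf : bijective f) c :
  A c -> A (sphere_comp bf c).
Proof.
have [g [fK gK]] := multiplicative_inverse bf.
have bg : bijective g by exists f.
by move=> Ac /(Sigma1_sphere_comp bg); rewrite sphere_compK.
Qed.

(** Continuity carries components into components, for [f] and for its inverse, so extremality can
    be transported. *)
Lemma extremal_component_comp (f : {multiplicative G -> G}) (bf : bijective f)
    c (chi : nonzero_character R G) :
  extremal (connected_component A c) chi ->
  extremal (connected_component A (sphere_comp bf c)) (nz_char_comp bf chi).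
Proof.
have [g [fK gK]] := multiplicative_inverse bf.
have bg : bijective g by exists f.
have comp_image (k : {multiplicative G -> G}) (bk : bijective k) x y :
    connected_component A x y ->
    connected_component A (sphere_comp bk x) (sphere_comp bk y).
  apply: connected_component_image; first exact: sphere_comp_continuous.
  by move=> _ [z Az <-]; exact: setC_Sigma1_sphere_comp.
move=> /[dup] ext [cchi _]; apply: (extremal_nz_char_comp (bg := bg) fK gK) ext.
- exact: comp_image.
- by move=> d /(comp_image g bg); rewrite sphere_compK.
Qed.

Definition aut_orbit chi : set (nonzero_character R G) :=
  [set psi | exists f : {multiplicative G -> G},
    bijective f /\ psi = char_comp f chi :> character R G].

Lemma aut_orbit_comp (f : {multiplicative G -> G}) (bf : bijective f) chi psi :
  aut_orbit chi psi -> aut_orbit chi (nz_char_comp bf psi).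
Proof.
move=> [g [bg e]]; exists (g \o f); split; first exact: bij_comp.
by rewrite /= e; exact/character_eqP.
Qed.

(** If the pullbacks along [f1] and [f2] differ by a factor [r], then [f1 \o g2], with [g2] inverse
    to [f2], scales [chi] by [r], so [r = 1]. *)
Lemma aut_orbit_ray_inj chi : finitely_generated G -> transcendental chi ->
  {in aut_orbit chi &, injective ray}.
Proof.
move=> fgG trchi psi1 psi2 /set_mem[f1 [bf1 e1]] /set_mem[f2 [bf2 e2]].
move=> /ray_eq[r r0 e12]; have [g2 [f2K g2K]] := multiplicative_inverse bf2.
have r1 : r = 1.
  apply: (transcendental_fixed_ray (f := f1 \o g2) fgG _ trchi _ r0).
  - exact: nz_charP.
  - by apply: bij_comp => //; exists f2.
  - apply/character_eqP => x; move/character_eqP/(_ (g2 x)): e12.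
    by rewrite e1 e2 !char_scaleE /= g2K.
by apply/val_inj; rewrite /= e12 r1 scale1r.
Qed.

Lemma finite_aut_orbit_invariant (chi : nonzero_character R G) (g : G) :
  finite_set (aut_orbit chi) ->
  (forall psi, aut_orbit chi psi -> 0 < psi g) -> property_R_chi_infty R G.
Proof.
move=> finO Og.
pose s : character R G := \sum_(psi \in aut_orbit chi) (psi : character R G).
have chiO : aut_orbit chi chi.
  by exists idfun; split; [exists id|exact/character_eqP].
exists s => [|f bf].
  have evalD : {morph (fun psi : character R G => psi g) : x y / x + y} by [].
  apply/eqP => /character_eqP/(_ g).
  rewrite /s fsbig_finite//=.
  rewrite (big_morph _ evalD (erefl : (0 : character R G) g = 0)).
  apply/eqP; rewrite gt_eqF// (bigD1_seq chi)/= ?in_fset_set ?inE//;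
    last exact: finmap.fset_uniq.
  rewrite ltr_pwDl ?Og// big_seq_cond sumr_ge0// => psi /andP[].
  by rewrite in_fset_set// inE => /Og/ltW.
suff : char_comp f s = s by move/(congr1 (@char_fun R G)).
have [h [fK hK]] := multiplicative_inverse bf.
have bh : bijective h by exists f.
(* Pullback along [f] permutes the orbit, so it only reindexes the sum. *)
rewrite [in RHS]/s (reindex_fsbig (nz_char_comp bf) (aut_orbit chi)).
  by rewrite /s !fsbig_finite//= linear_sum.
split => [psi /(aut_orbit_comp bf)//|psi1 psi2 _ _|psi Opsi].
  exact/can_inj/(nz_char_compK bf bh hK).
by exists (nz_char_comp bh psi); [exact: aut_orbit_comp|exact: nz_char_compK].
Qed.

Lemma class_S_R_chi_infty : class_S R G -> property_R_chi_infty R G.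
Proof.
move=> [fgG [[c Ac] [g Ag]] fin poly].
have [m [v [vP vtr]]] := poly c Ac.
(* With no vertices the only combination is 0, but the component contains the class [c] of a nonzero
   character. *)
have [j] : exists j : 'I_m, True.
  apply: contrapT => /forallNP nj; have := connected_component_refl Ac.
  have [chi chiE] := ray_surj c; rewrite [X in _ _ _ X]chiE.
  move=> /(polytope_rayP vP chi).1[a _].
  rewrite big1 => [/eqP|i _]; first exact/negP/nz_charP.
  by case: (nj i).
move=> _; pose chi := vertex vP j.
pose P (f : {multiplicative G -> G}) (bf : bijective f) :=
  connected_component A (sphere_comp bf c).
have ext (f : {multiplicative G -> G}) (bf : bijective f) :
    extremal (P f bf) (nz_char_comp bf chi).
  exact/extremal_component_comp/extremal_vertex.
have orbitE psi : aut_orbit chi psi ->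
    exists (f : {multiplicative G -> G}) (bf : bijective f),
      psi = nz_char_comp bf chi.
  by move=> [f [bf e]]; exists f, bf; apply/val_inj.
apply: (@finite_aut_orbit_invariant chi g).
  (* As [ray] is injective on the orbit, it suffices to bound the set of rays, which are all
     extremal in one of the finitely many components. *)
  rewrite -(eq_finite_set (inj_card_eq (@aut_orbit_ray_inj chi fgG (vtr j)))).
  pose E := \bigcup_(P in [set connected_component A d | d in A])
    [set ray psi | psi in extremal P].
  apply: (@sub_finite_set _ _ E).
    move=> _ [psi /orbitE[f [bf ->]] <-]; exists (P f bf).
      by exists (sphere_comp bf c) => //; exact: setC_Sigma1_sphere_comp.
    by exists (nz_char_comp bf chi).
  apply: bigcup_finite fin _ => _ [d Ad <-].
  by have [n [w [wP _]]] := poly d Ad; exact: finite_extremal_rays wP.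
move=> psi /orbitE[f [bf ->]].
(* The hemisphere provides some representative positive at [g]; positive scaling passes this on to
   the orbit element. *)
have /Ag[psi' psi'g /ray_eq[r r0 e]] : A (ray (nz_char_comp bf chi)).
  by have [/connected_component_sub] := ext f bf.
by move: psi'g; rewrite /= e char_scaleE pmulr_rgt0.
Qed.

End VertexOrbit.

(** * From a characteristic quotient back to the group *)

Section CharacteristicQuotient.
Variables (R : realType) (G : groupType) (K : normal_subgroup G).

Local Notation Q := (quotient_group K).

Lemma pi_quotient_groupM : {morph \pi_Q : x y / (x * y)%g >-> (x * y)%g}.
Proof. by move=> x y; rewrite -(pi_qg_mul K x y). Qed.

Fact char_pi_subproof (chi : character R Q) : (chi \o \pi_Q) \in @is_hom R G.
Proof. by apply/asboolP => x y /=; rewrite pi_quotient_groupM charM. Qed.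

Lemma pi_quotient_groupP (x y : G) :
  reflect (\pi_Q x = \pi_Q y) ((x^-1 * y)%g \in (K : {pred G})).
Proof. exact: eqmodP. Qed.

(** The representative differs from [x] by an element of [K], which [f] keeps in [K]. *)
Lemma repr_quotient_group (f : {multiplicative G -> G}) (x : G) :
  (forall y, y \in (K : {pred G}) -> f y \in (K : {pred G})) ->
  \pi_Q (f (repr (\pi_Q x))) = \pi_Q (f x).
Proof.
move=> fK; apply/pi_quotient_groupP; rewrite -multiplicativeV -gmulfM.
apply: fK.
by apply/pi_quotient_groupP; rewrite reprK.
Qed.

Lemma characteristic_quotient :
  characteristic K -> property_R_chi_infty R Q -> property_R_chi_infty R G.
Proof.
move=> charK [chi chi0 inv]; exists (Character (char_pi_subproof chi)).
  apply: contra_neq chi0 => /character_eqP e; apply/character_eqP => a.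
  by have := e (repr a); rewrite /= reprK.
have stable (f : {multiplicative G -> G}) : bijective f ->
    forall y, y \in (K : {pred G}) -> f y \in (K : {pred G}).
  move=> bf y Ky; have : [set` K] (f y) by rewrite -(charK f bf); exists y.
  by [].
move=> f bf; have [g [fK gK]] := multiplicative_inverse bf.
have bg : bijective g by exists f.
(* The automorphism descends to the quotient, with inverse induced by [g]; invariance of [chi] under
   it is invariance of the pullback under [f]. *)
pose fQ (a : Q) : Q := \pi_Q (f (repr a)).
pose gQ (a : Q) : Q := \pi_Q (g (repr a)).
have fQE x : fQ (\pi_Q x) = \pi_Q (f x) by exact/repr_quotient_group/stable.
have gQE x : gQ (\pi_Q x) = \pi_Q (g x) by exact/repr_quotient_group/stable.
have fQM : {morph fQ : a b / (a * b)%g >-> (a * b)%g}.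
  elim/quotW=> x; elim/quotW=> y.
  by rewrite -pi_quotient_groupM !fQE gmulfM pi_quotient_groupM.
pose F := HB.pack_for {multiplicative Q -> Q} fQ
  (isMultiplicative.Build _ _ fQ fQM).
have bF : bijective F.
  exists gQ => a; rewrite -[a]reprK; move: (repr a) => x.
    by rewrite [F _]fQE gQE fK.
  by rewrite gQE [F _]fQE gK.
apply/funext => x /=; have := congr1 (fun k => k (\pi_Q x)) (inv F bF).
by rewrite /= fQE.
Qed.

End CharacteristicQuotient.

Theorem theorem3p5 (R : realType) (G : groupType) :
  class_S_tilde R G -> property_R_chi_infty R G.
Proof.
by move=> [K [charK /class_S_R_chi_infty]]; exact: characteristic_quotient.
Qed.
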